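(* Let $\lambda\ge1$ be an integer. Any algorithm that is given an integer $\kappa$ and query access (in the general graph query model) to an $n$-vertex graph $G$ with $\kappa(G)=\kappa$, and that with probability at least $2/3$ produces a proper $(\kappa+\lambda)$-coloring of $G$, must make $\Omega(n^2/\lambda^2)$ queries.
   Context: In the general graph query model the algorithm knows the vertex set $[n]$ and accesses $G$ only via pair queries $\mathrm{Pair}(u,v)$ (returning whether $\{u,v\}\in E(G)$) and neighbor queries $\mathrm{Nbr}(u,j)$ (returning the $j$th neighbor of $u$ in a fixed ordering of its adjacency list, or $\bot$ if none). $\kappa(G)$ is the degeneracy of $G$: the least $k$ such that every induced subgraph has a vertex of degree at most $k$. *)

(* Defs.v *)
From HB Require Import structures.
From mathcomp Require Export all_boot all_order all_algebra.
From mathcomp Require Export all_classical all_reals all_analysis.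

Set Implicit Arguments.
Unset Strict Implicit.
Unset Printing Implicit Defensive.

(* A simple graph on [n] as a query algorithm accesses it, that is, together
   with an arbitrary (not necessarily sorted) ordering of each adjacency list. *)
Record query_graph (n : nat) := QueryGraph {
  adj : rel 'I_n;
  adj_sym : symmetric adj;
  adj_irr : irreflexive adj;
  adj_list : 'I_n -> seq 'I_n;
  adj_list_uniq : forall u, uniq (adj_list u);
  mem_adj_list : forall u v, (v \in adj_list u) = adj u v
}.

Definition induced_degree (n : nat) (G : query_graph n) (S : {set 'I_n})
    (v : 'I_n) : nat := #|[pred w in S | adj G v w]|.

Definition degenerate (n : nat) (G : query_graph n) (k : nat) : bool :=
  [forall S : {set 'I_n}, (S != finset.set0) ==>
     [exists v in S, induced_degree G S v <= k]].

Lemma degenerate_ex (n : nat) (G : query_graph n) :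
  exists k, degenerate G k.
Proof.
exists n; apply/forallP => S; apply/implyP => /finset.set0Pn[v vS].
apply/existsP; exists v; rewrite vS /=.
by rewrite -[X in _ <= X](card_ord n) max_card.
Qed.

Definition degeneracy (n : nat) (G : query_graph n) : nat :=
  ex_minn (degenerate_ex G).

Definition proper_coloring (n k : nat) (G : query_graph n)
    (c : {ffun 'I_n -> nat}) : Prop :=
  (forall v, c v < k) /\ (forall u v, adj G u v -> c u != c v).

(* Deterministic adaptive query algorithms: the continuation of a query
   receives its answer, and computation between queries is unrestricted. *)
Inductive query_tree (n : nat) (O : Type) : Type :=
| Output of O
| Pair of 'I_n & 'I_n & (bool -> query_tree n O)
| Nbr of 'I_n & nat & (option 'I_n -> query_tree n O).

(* [Nbr u j] is indexed from 0; the answer [None] stands for "no such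
   neighbor". *)
Fixpoint run (n : nat) (O : Type) (G : query_graph n) (t : query_tree n O) : O :=
  match t with
  | Output o => o
  | Pair u v k => run G (k (adj G u v))
  | Nbr u j k => run G (k (onth (adj_list G u) j))
  end.

Fixpoint num_queries (n : nat) (O : Type) (G : query_graph n)
    (t : query_tree n O) : nat :=
  match t with
  | Output _ => 0
  | Pair u v k => (num_queries G (k (adj G u v))).+1
  | Nbr u j k => (num_queries G (k (onth (adj_list G u) j))).+1
  end.

(* A randomized algorithm is a deterministic one chosen by a random seed in T.
   The measurability conditions only say that, on each input, the output and
   the number of queries are (discrete) random variables. *)
Record rand_query_alg (d : measure_display) (T : measurableType d) (n : nat)
    (O : Type) := RandQueryAlg {
  tree_of_seed :> T -> query_tree n O;
  measurable_run : forall (G : query_graph n) (B : set O),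
    measurable [set r : T | B (run G (tree_of_seed r))]%classic;
  measurable_num_queries : forall (G : query_graph n) (B : set nat),
    measurable [set r : T | B (num_queries G (tree_of_seed r))]%classic
}.

(* Main.v *)
Require Import Defs.
From mathcomp Require Import zify lra measurable_realfun.
Import Order.TTheory GRing.Theory Num.Theory.

Set Implicit Arguments.
Unset Strict Implicit.
Unset Printing Implicit Defensive.

(* Hide a missing block pair in a clique. Take p blocks of lambda vertices in
   each of four parts: a clique and a bipartite graph, each with a left and a
   right side; the remaining vertices stay isolated. Initially all pairs
   inside the clique and all left-right pairs of the bipartite graph are
   adjacent. For a hidden pair (i, j), exchange edges and non-edges between
   the left blocks i and the right blocks j of both graphs. Every degree is
   preserved, so the adjacency lists change only in the slots of the switched
   pairs, and the degeneracy drops to kappa = 2 lambda p - 1 - lambda. With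
   kappa + lambda = 2 lambda p - 1 colors some pair of clique vertices is
   monochromatic; it must have been switched, hence reveals (i, j). A query
   to the unswitched graph also concerns only one of the p^2 hidden pairs, so
   a deterministic algorithm with Q queries succeeds for at most Q + 1 of
   them. Averaging over the hidden pair gives (2/3) p^2 <= Q + 1 for p = n/(4
   lambda). *)

Section MeasureOverlap.
Local Open Scope classical_set_scope.
Local Open Scope ring_scope.

Lemma sum_measure_le_overlap (R : realType) (d : measure_display)
    (T : measurableType d) (mu : {measure set T -> \bar R}) (I : finType)
    (E : I -> set T) (M : nat) :
  (forall i, measurable (E i)) ->
  (forall r, #|[pred i | r \in E i]| <= M)%N ->
  (\sum_i mu (E i) <= M%:R%:E * mu [set: T])%E.
Proof.
move=> mE EM.
have mf i : measurable_fun [set: T] (EFin \o (\1_(E i) : T -> R)).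
  by apply/measurable_EFinP; exact: measurable_indic.
have -> : (\sum_i mu (E i) =
    \int[mu]_r (\sum_(i <- index_enum I) (\1_(E i) r : R)%:E))%E.
  rewrite ge0_integral_sum//.
  by apply: eq_bigr => i _; rewrite integral_indic// setIT.
rewrite -integral_cst//; apply: ge0_le_integral => //.
- by move=> r _; apply: sume_ge0.
- exact: emeasurable_sum.
move=> r _; rewrite sumEFin lee_fin.
rewrite (_ : \sum_i _ = #|[pred i | r \in E i]|%:R) ?ler_nat//.
rewrite -sum1_card natr_sum [RHS]big_mkcond; apply: eq_bigr => i _.
by rewrite indicE inE; case: (_ \in _).
Qed.

End MeasureOverlap.

Lemma card_dependent_pred (I : finType) (T : eqType) (a0 : T) (a : I -> T)
    (B : T -> pred I) :
  #|[pred i | B (a i) i]| <= #|[pred i | a i != a0]| + #|B a0|.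
Proof.
rewrite -cardUI; apply: leq_trans (leq_addr _ _); apply: subset_leq_card.
by apply/fintype.subsetP => i; rewrite !inE; case: eqVneq => // ->.
Qed.

Section QueryLowerBound.
Variables (n : nat) (I : finType) (G0 : query_graph n) (G : I -> query_graph n).
Variable D : nat.
Hypothesis card_pair_changes :
  forall u v, #|[pred i | adj (G i) u v != adj G0 u v]| <= D.
Hypothesis card_nbr_changes : forall u j,
  #|[pred i | onth (adj_list (G i) u) j != onth (adj_list G0 u) j]| <= D.
Variables (O : Type) (ok : I -> set O) (N : nat).
Hypothesis card_ok : forall x, #|[pred i | `[< ok i x >]]| <= N.

(* As long as the answers are those of [G0], the run does not depend on [i], and
   each query loses at most the [D] indices whose answer differs. *)
Lemma card_short_success (Q : nat) (t : query_tree n O) :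
  #|[pred i | (num_queries (G i) t <= Q) && `[< ok i (run (G i) t) >]]|
    <= D * Q + N.
Proof.
pose short_success Q' t' i :=
  (num_queries (G i) t' <= Q') && `[< ok i (run (G i) t') >].
elim: t Q => [x|u v k IHk|u j k IHk] [|Q].
- exact: leq_trans (card_ok x) (leq_addl _ _).
- exact: leq_trans (card_ok x) (leq_addl _ _).
- by rewrite eq_card0.
- rewrite mulnS -addnA.
  apply: leq_trans (leq_add (card_pair_changes u v) (IHk (adj G0 u v) Q)).
  exact: (card_dependent_pred _ _ (fun a => short_success Q (k a))).
- by rewrite eq_card0.
- rewrite mulnS -addnA; set a0 := onth (adj_list G0 u) j.
  apply: leq_trans (leq_add (card_nbr_changes u j) (IHk a0 Q)).
  exact: (card_dependent_pred _ _ (fun a => short_success Q (k a))).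
Qed.

Local Open Scope classical_set_scope.
Local Open Scope ring_scope.

Lemma exists_long_run (R : realType) (d : measure_display)
    (T : measurableType d) (P : probability T R) (A : rand_query_alg T n O)
    (delta X : R) (Q : nat) :
  (forall i, (delta%:E <= P [set r | ok i (run (G i) (A r))])%E) ->
  (D * Q + N)%:R < delta * #|I|%:R -> X <= Q.+1%:R ->
  exists i, (0 < P [set r | (X <= (num_queries (G i) (A r))%:R)%R])%E.
Proof.
move=> A_ok count_lt XQ; apply: contrapT => /forallNP long_null.
pose success i := [set r | ok i (run (G i) (A r))].
pose long i := [set r | X <= (num_queries (G i) (A r))%:R].
have msuccess i : measurable (success i) by exact: (measurable_run A (G i)).
have mlong i : measurable (long i).
  exact: (measurable_num_queries A (G i) [set q | X <= q%:R]).
have Psuccess i : (delta%:E <= P (success i `\` long i))%E.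
  apply: le_trans (A_ok i) _.
  rewrite -/(success i) (measureDI P (msuccess i) (mlong i)).
  have Plong : P (long i) = 0.
    by apply/eqP; rewrite -measure_le0 leNgt; apply/negP; exact: long_null.
  rewrite (subset_measure0 _ (mlong i) (@subIsetr _ _ _) Plong) ?adde0//.
  exact: measurableI.
have : (\sum_i P (success i `\` long i) <= (D * Q + N)%:R%:E)%E.
  rewrite -[leRHS]mule1 -(probability_setT P).
  apply: sum_measure_le_overlap => [i|r]; first exact: measurableD.
  apply: leq_trans (card_short_success Q (A r)); apply: subset_leq_card.
  apply/fintype.subsetP => i; rewrite !inE => -[succ /negP].
  rewrite -ltNge => /lt_le_trans/(_ XQ); rewrite ltr_nat ltnS => ->.
  exact/asboolP.
apply/negP; rewrite -ltNge.
apply: lt_le_trans (lee_sum _ (fun i _ => Psuccess i)).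
by rewrite sumEFin sumr_const lte_fin -[ltRHS]mulr_natr.
Qed.

End QueryLowerBound.

Definition degree_in (V : finType) (e : rel V) (S : {set V}) (x : V) : nat :=
  #|[pred y in S | e x y]|.

Section DegreeIn.
Variables (V : finType) (e : rel V).
Implicit Types (S U : {set V}) (x : V).

Lemma leq_degree_in S U x :
  (forall y, y \in S -> e x y -> y \in U) -> degree_in e S x <= #|U|.
Proof.
move=> eSU; apply: subset_leq_card; apply/fintype.subsetP => y.
by rewrite inE => /andP[]; exact: eSU.
Qed.

Hypothesis e_irr : irreflexive e.

Lemma degree_in_lt_card S x : x \in S -> degree_in e S x < #|S|.
Proof.
move=> xS; rewrite (cardsD1 x) xS add1n ltnS.
apply: leq_degree_in => y yS exy; rewrite in_setD1 yS andbT.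
by apply: contraTneq exy => ->; rewrite e_irr.
Qed.

Lemma degree_in_clique S x :
  {in S &, forall y z, y != z -> e y z} -> x \in S ->
  degree_in e S x = #|S|.-1.
Proof.
move=> e_clique xS; rewrite (cardsD1 x) xS; apply: eq_card => y.
rewrite !inE andbC; case: (boolP (y \in S)) => [yS|]; last by rewrite !andbF.
rewrite !andbT; case: eqVneq => [->|yx]; first exact: e_irr.
by rewrite e_clique// eq_sym.
Qed.

End DegreeIn.

Lemma degeneracy_eq (n : nat) (G : query_graph n) (k : nat) (S : {set 'I_n}) :
  degenerate G k -> S != finset.set0 ->
  {in S, forall v, k <= induced_degree G S v} -> degeneracy G = k.
Proof.
move=> Gk S0 kS; rewrite /degeneracy; case: ex_minnP => l Gl /(_ _ Gk) lk.
apply/eqP; rewrite eqn_leq lk.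
have /existsP[v /andP[vS vl]] := implyP (forallP Gl S) S0.
exact: leq_trans (kS v vS) vl.
Qed.

Section EmbeddedGraph.
Variables (V : finType) (n : nat).
Hypothesis leVn : #|V| <= n.

Definition place (x : V) : 'I_n := widen_ord leVn (enum_rank x).

Definition unplace (v : 'I_n) : option V :=
  omap enum_val (insub (val v) : option 'I_#|V|).

Lemma placeK : pcancel place unplace.
Proof. by move=> x; rewrite /unplace valK /= enum_rankK. Qed.

Lemma place_inj : injective place.
Proof. exact: pcan_inj placeK. Qed.

Lemma unplaceK : ocancel unplace place.
Proof.
move=> v; rewrite /unplace; case: insubP => //= i _ iv.
by apply: val_inj; rewrite /= enum_valK.
Qed.

Variables (e : rel V) (nbrs : V -> seq V).
Hypotheses (e_sym : symmetric e) (e_irr : irreflexive e).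
Hypothesis nbrs_uniq : forall x, uniq (nbrs x).
Hypothesis mem_nbrs : forall x y, (y \in nbrs x) = e x y.

Definition embed_adj (u v : 'I_n) : bool :=
  if (unplace u, unplace v) is (Some x, Some y) then e x y else false.

Definition embed_list (u : 'I_n) : seq 'I_n :=
  map place (oapp nbrs [::] (unplace u)).

Lemma embed_adj_sym : symmetric embed_adj.
Proof.
move=> u v; rewrite /embed_adj.
by case: (unplace u) => [x|]; case: (unplace v) => [y|].
Qed.

Lemma embed_adj_irr : irreflexive embed_adj.
Proof. by move=> u; rewrite /embed_adj; case: (unplace u). Qed.

Lemma embed_list_uniq u : uniq (embed_list u).
Proof. by rewrite (map_inj_uniq place_inj); case: (unplace u). Qed.

Lemma mem_embed_list u v : (v \in embed_list u) = embed_adj u v.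
Proof.
rewrite /embed_list /embed_adj; case: (unplace u) => //= x.
case vE: (unplace v) (unplaceK v) => [y|] /= => [<-|_].
  by rewrite (mem_map place_inj) mem_nbrs.
by apply/negbTE/mapP => -[y _ yE]; rewrite yE placeK in vE.
Qed.

Definition embed_graph : query_graph n :=
  QueryGraph embed_adj_sym embed_adj_irr embed_list_uniq mem_embed_list.

Lemma adj_embed_place x y : adj embed_graph (place x) (place y) = e x y.
Proof. by rewrite /= /embed_adj !placeK. Qed.

Lemma induced_degree_embed (S : {set 'I_n}) x :
  induced_degree embed_graph S (place x) = degree_in e (place @^-1: S) x.
Proof.
rewrite /degree_in -(fintype.card_image place_inj); apply: eq_card => v.
apply/andP/fintype.imageP => [[vS]|[y]]; last first.
  by rewrite !inE => /andP[yS exy] ->; rewrite -adj_embed_place in exy.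
rewrite /= /embed_adj placeK; move: (unplaceK v).
case: (unplace v) => //= y vE exy.
by exists y; rewrite // !inE vE vS.
Qed.

Lemma degenerate_embed k :
  (forall U, U != finset.set0 -> exists2 x, x \in U & degree_in e U x <= k) ->
  degenerate embed_graph k.
Proof.
move=> e_degenerate; apply/forallP => S; apply/implyP => /finset.set0Pn[v vS].
case vE: (unplace v) (unplaceK v) => [x|] /= => [xv|_].
  have [|y yS yk] := e_degenerate (place @^-1: S).
    by apply/finset.set0Pn; exists x; rewrite inE xv.
  apply/existsP; exists (place y); rewrite induced_degree_embed yk andbT.
  by rewrite inE in yS.
apply/existsP; exists v; rewrite vS /induced_degree eq_card0// => w.
by rewrite !inE /= /embed_adj vE andbF.
Qed.

Lemma degeneracy_embed k (U : {set V}) :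
  (forall S, S != finset.set0 -> exists2 x, x \in S & degree_in e S x <= k) ->
  U != finset.set0 -> {in U, forall x, k <= degree_in e U x} ->
  degeneracy embed_graph = k.
Proof.
move=> e_degenerate U0 kU.
apply: (@degeneracy_eq _ _ _ (place @: U)); first exact: degenerate_embed.
  by rewrite imset_eq0.
move=> _ /imsetP[x xU ->].
rewrite induced_degree_embed (_ : _ @^-1: _ = U) ?kU//; apply/setP => y.
by rewrite inE (mem_imset _ _ place_inj).
Qed.

End EmbeddedGraph.

Section SwitchedGraph.
Variables lam p : nat.

(* A vertex is given by its part, that is, whether it lies in the clique and
   whether it is on the left, its position in its block, and its block. *)
Definition vertex : finType := ((bool * bool) * ('I_lam * 'I_p))%type.

Definition in_clique (x : vertex) : bool := x.1.1.
Definition on_left (x : vertex) : bool := x.1.2.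
Definition block (x : vertex) : 'I_p := x.2.2.
Definition mirror (x : vertex) : vertex := ((~~ in_clique x, on_left x), x.2).

Definition block_pair (x y : vertex) : 'I_p * 'I_p :=
  if on_left x then (block x, block y) else (block y, block x).

(* [h] is the hidden pair of blocks; nothing is switched for [None]. *)
Definition switched (h : option ('I_p * 'I_p)) (x y : vertex) : bool :=
  (on_left x != on_left y) && (h == Some (block_pair x y)).

Definition base_adj (x y : vertex) : bool :=
  if on_left x == on_left y then [&& in_clique x, in_clique y & x != y]
  else in_clique x == in_clique y.

Implicit Types (h : option ('I_p * 'I_p)) (x y : vertex).

Definition switched_adj h : rel vertex := fun x y =>
  base_adj x y (+) switched h x y.

Lemma base_adj_sym : symmetric base_adj.
Proof.
move=> x y; rewrite /base_adj andbCA (eq_sym y) (eq_sym (on_left y)).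
by rewrite (eq_sym (in_clique y)).
Qed.

Lemma switched_sym h : symmetric (switched h).
Proof.
move=> x y; rewrite /switched /block_pair (eq_sym (on_left y)).
by case: (on_left x); case: (on_left y).
Qed.

Lemma switched_adj_sym h : symmetric (switched_adj h).
Proof. by move=> x y; rewrite /switched_adj base_adj_sym switched_sym. Qed.

Lemma switched_adj_irr h : irreflexive (switched_adj h).
Proof. by move=> x; rewrite /switched_adj /base_adj /switched !eqxx !andbF. Qed.

Lemma switched_None x y : switched None x y = false.
Proof. exact: andbF. Qed.

Lemma switched_block_pair h x y :
  switched h x y -> h = Some (block_pair x y).
Proof. by case/andP => _ /eqP. Qed.

Lemma switched_adj_Some_neq ij x y :
  switched_adj (Some ij) x y != switched_adj None x y -> ij = block_pair x y.
Proof.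
rewrite /switched_adj switched_None addbF.
case: (boolP (switched _ _ _)) => [/switched_block_pair[]//|_].
by rewrite addbF eqxx.
Qed.

Definition switch_nbr h x y : vertex := if switched h x y then mirror y else y.

Lemma mirrorK : involutive mirror.
Proof. by case=> [[a b] v]; rewrite /mirror /in_clique /on_left /= negbK. Qed.

Lemma switch_nbr_Some_neq ij x y :
  switch_nbr (Some ij) x y != switch_nbr None x y -> ij = block_pair x y.
Proof.
rewrite /switch_nbr switched_None.
by case: ifP => [/switched_block_pair[]|]; rewrite ?eqxx.
Qed.

Lemma switch_nbrK h x : involutive (switch_nbr h x).
Proof.
move=> y; rewrite {2}/switch_nbr; case: ifPn => xy.
  by rewrite /switch_nbr [switched h x (mirror y)]xy mirrorK.
by rewrite /switch_nbr (negbTE xy).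
Qed.

Lemma base_adj_switch_nbr h x y :
  base_adj x (switch_nbr h x y) = switched_adj h x y.
Proof.
rewrite /switch_nbr /switched_adj; case: ifPn => [/andP[xy _]|_]; last first.
  by rewrite addbF.
rewrite addbT /base_adj -[on_left (mirror y)]/(on_left y) (negbTE xy).
by rewrite /mirror /in_clique; case: (x.1.1); case: (y.1.1).
Qed.

Definition switched_nbrs h x : seq vertex :=
  map (switch_nbr h x) (enum (base_adj x)).

Lemma switched_nbrs_uniq h x : uniq (switched_nbrs h x).
Proof.
by rewrite map_inj_uniq ?enum_uniq//; exact: inv_inj (switch_nbrK h x).
Qed.

Lemma mem_switched_nbrs h x y : (y \in switched_nbrs h x) = switched_adj h x y.
Proof.
rewrite -{1}(switch_nbrK h x y) mem_map; last exact: inv_inj (switch_nbrK h x).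
by rewrite mem_enum -base_adj_switch_nbr.
Qed.

Lemma card_switched_adj h x : #|switched_adj h x| = #|base_adj x|.
Proof.
rewrite [RHS]cardE -(size_map (switch_nbr h x)).
rewrite -(card_uniqP (switched_nbrs_uniq h x)).
by apply: eq_card => y; rewrite mem_switched_nbrs.
Qed.

Definition clique_set : {set vertex} := [set x | in_clique x].

Definition clique_block (left : bool) (i : 'I_p) : {set vertex} :=
  [set x | [&& in_clique x, on_left x == left & block x == i]].

Lemma card_vertex : #|vertex| = 4 * (lam * p).
Proof. by rewrite !card_prod card_bool !card_ord. Qed.

Lemma card_clique_set : #|clique_set| = 2 * (lam * p).
Proof.
pose clique_parts := finset.setX [set true] [set: bool].
rewrite (_ : clique_set = finset.setX clique_parts [set: 'I_lam * 'I_p]).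
  by rewrite !cardsX cards1 !cardsT card_bool card_prod !card_ord.
by apply/setP => -[[a b] [l k]]; rewrite !inE /in_clique /= !andbT; case: a.
Qed.

Lemma card_clique_block left i : #|clique_block left i| = lam.
Proof.
pose part := finset.setX [set true] [set left].
pose positions := finset.setX [set: 'I_lam] [set i].
rewrite (_ : clique_block left i = finset.setX part positions).
  by rewrite !cardsX !cards1 !cardsT !card_ord !muln1 mul1n.
apply/setP => -[[a b] [l k]].
by rewrite !inE /in_clique /on_left /block /= -andbA; case: a.
Qed.

Lemma clique_block_sub left i : clique_block left i \subset clique_set.
Proof. by apply/fintype.subsetP => x; rewrite !inE => /andP[]. Qed.

Lemma card_base_adj_bipartite x : ~~ in_clique x -> #|base_adj x| = lam * p.
Proof.
move=> /negbTE xNclique.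
pose opposite_part := finset.setX [set false] [set ~~ on_left x].
rewrite (eq_card (B := finset.setX opposite_part [set: 'I_lam * 'I_p])).
  by rewrite !cardsX !cards1 cardsT card_prod !card_ord !mul1n.
case=> [[a b] v]; rewrite !inE /= /in_mem /= /base_adj xNclique.
by rewrite /in_clique /on_left /= andbT; case: a; case: b; case: (x.1.2).
Qed.

Definition clique_core (i : 'I_p) : {set vertex} :=
  clique_set :\: clique_block true i.

Lemma card_clique_core i : #|clique_core i| = 2 * (lam * p) - lam.
Proof.
rewrite cardsD (finset.setIidPr (clique_block_sub _ _)).
by rewrite card_clique_set card_clique_block.
Qed.

Lemma base_adj_clique_set :
  {in clique_set &, forall x y, x != y -> base_adj x y}.
Proof. by move=> x y; rewrite !inE /base_adj => -> -> ->; rewrite if_same. Qed.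

Lemma switched_adj_clique_core i j :
  {in clique_core i &, forall x y, x != y -> switched_adj (Some (i, j)) x y}.
Proof.
move=> x y; rewrite !finset.in_setD => /andP[xi x_cl] /andP[yi y_cl] xy.
rewrite /switched_adj base_adj_clique_set// addTb.
move: xi yi x_cl y_cl; rewrite !inE => xi yi x_cl y_cl.
rewrite x_cl in xi; rewrite y_cl in yi.
apply/negP => /andP[xy_side /eqP[]]; rewrite /block_pair.
case: (on_left x) xi xy_side => [xi _ [iE _]|_ y_side [iE _]].
  by rewrite iE !eqxx in xi.
by move: y_side yi; rewrite iE !eqxx; case: (on_left y).
Qed.

Hypotheses (lam_gt0 : 0 < lam) (p_gt1 : 1 < p).

Definition switched_degeneracy : nat := 2 * (lam * p) - lam.+1.

Let double_lam_le : lam + lam <= lam * p.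
Proof. by rewrite addnn -muln2 leq_mul2l p_gt1 orbT. Qed.

Lemma degree_in_bipartite h S x :
  ~~ in_clique x -> degree_in (switched_adj h) S x <= switched_degeneracy.
Proof.
move=> xNclique; apply: (@leq_trans #|switched_adj h x|).
  by apply: subset_leq_card; apply/fintype.subsetP => y; rewrite inE => /andP[].
rewrite card_switched_adj card_base_adj_bipartite// /switched_degeneracy.
by move: double_lam_le lam_gt0; lia.
Qed.

Lemma degree_in_clique_block i j (S : {set vertex}) x :
  S \subset clique_set -> x \in clique_block true i ->
  degree_in (switched_adj (Some (i, j))) S x <= switched_degeneracy.
Proof.
move=> /fintype.subsetP S_cl xi.
have x_cl : x \in clique_set := fintype.subsetP (clique_block_sub _ _) x xi.
have [x_left xE] : on_left x = true /\ block x = i.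
  by move: xi; rewrite inE => /and3P[_ /eqP-> /eqP->].
apply: (@leq_trans #|(clique_set :\ x) :\: clique_block false j|).
  apply: leq_degree_in => y /S_cl y_cl xy.
  rewrite finset.in_setD finset.in_setD1 y_cl andbT; apply/andP; split.
    apply: contraTN xy; rewrite inE => /and3P[_ /eqP y_right /eqP yj].
    move: x_cl y_cl; rewrite !inE => x_cl y_cl.
    rewrite /switched_adj /base_adj /switched /block_pair.
    by rewrite x_left y_right x_cl y_cl xE yj /= eqxx.
  by apply: contraTneq xy => ->; rewrite switched_adj_irr.
rewrite cardsD (finset.setIidPr _) ?card_clique_block; last first.
  by rewrite subsetD1 clique_block_sub inE x_left andbF.
have := cardsD1 x clique_set; rewrite x_cl card_clique_set.
by rewrite /switched_degeneracy; lia.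
Qed.

Lemma switched_adj_degenerate i j (S : {set vertex}) : S != finset.set0 ->
  exists2 x, x \in S &
    degree_in (switched_adj (Some (i, j))) S x <= switched_degeneracy.
Proof.
move=> /finset.set0Pn[x0 x0S].
have [S_cl|/subsetPn[x xS x_cl]] := boolP (S \subset clique_set); last first.
  by exists x => //; apply: degree_in_bipartite; rewrite inE in x_cl.
have [x /andP[xS xi]|Sblock] := pickP [pred x in S | x \in clique_block true i].
  by exists x => //; exact: degree_in_clique_block.
exists x0 => //.
have deg_x0 := degree_in_lt_card (switched_adj_irr (Some (i, j))) x0S.
have : #|S| <= #|clique_core i|.
  apply: subset_leq_card; apply/fintype.subsetP => x xS.
  have := Sblock x; rewrite /= xS /= => xi.
  by rewrite finset.in_setD xi (fintype.subsetP S_cl).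
by rewrite card_clique_core /switched_degeneracy; move: deg_x0; lia.
Qed.

Variable n : nat.
Hypothesis le_vertex_n : #|vertex| <= n.

Definition switched_graph h : query_graph n :=
  embed_graph le_vertex_n (@switched_adj_sym h) (@switched_adj_irr h)
    (switched_nbrs_uniq h) (mem_switched_nbrs h).

Lemma degeneracy_switched_graph ij :
  degeneracy (switched_graph (Some ij)) = switched_degeneracy.
Proof.
case: ij => i j; apply: (@degeneracy_embed _ _ _ _ _ _ _ _ _ _ (clique_core i)).
- exact: switched_adj_degenerate.
- by rewrite -card_gt0 card_clique_core; move: double_lam_le lam_gt0; lia.
- move=> x xi; rewrite (degree_in_clique (@switched_adj_irr _))//.
    by rewrite card_clique_core /switched_degeneracy subnS.
  exact: switched_adj_clique_core.
Qed.

Lemma card_pair_query_changes_le1 u v :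
  #|[pred ij | adj (switched_graph (Some ij)) u v
               != adj (switched_graph None) u v]| <= 1.
Proof.
apply/card_le1_eqP => ij kl; rewrite !inE /= /embed_adj.
case: (unplace vertex u) => [x|]; last by rewrite eqxx.
case: (unplace vertex v) => [y|]; last by rewrite eqxx.
by move=> /switched_adj_Some_neq -> /switched_adj_Some_neq ->.
Qed.

Lemma card_nbr_query_changes_le1 u j :
  #|[pred ij | onth (adj_list (switched_graph (Some ij)) u) j
               != onth (adj_list (switched_graph None) u) j]| <= 1.
Proof.
apply/card_le1_eqP => ij kl; rewrite !inE /= /embed_list.
case: (unplace vertex u) => [x|]; last by rewrite eqxx.
rewrite /= /switched_nbrs !onth_map; case: onth => [y|] //=.
have blocksE ij' : Some (place le_vertex_n (switch_nbr (Some ij') x y))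
    != Some (place le_vertex_n (switch_nbr None x y)) -> ij' = block_pair x y.
  by move=> neq; apply: switch_nbr_Some_neq; apply: contraNneq neq => ->.
by move=> /blocksE -> /blocksE ->.
Qed.

Lemma card_properly_colored_le1 (c : {ffun 'I_n -> nat}) :
  #|[pred ij | `[< proper_coloring (switched_degeneracy + lam)
                     (switched_graph (Some ij)) c >]]| <= 1.
Proof.
apply/card_le1_eqP => ij kl /asboolP[c_lt c_ij] /asboolP[_ c_kl].
pose color x : 'I_(switched_degeneracy + lam) :=
  Ordinal (c_lt (place le_vertex_n x)).
have : ~~ dinjectiveb color clique_set.
  apply/negP => /dinjectiveP/leq_card_in; rewrite card_clique_set card_ord.
  by rewrite /switched_degeneracy; move: double_lam_le lam_gt0; lia.
case/dinjectivePn => x x_cl [y /andP[yx y_cl] [cxy]].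
have blocksE h : (forall u v, adj (switched_graph h) u v -> c u != c v) ->
    h = Some (block_pair x y).
  move=> c_h; apply: switched_block_pair; apply: contraT => /negbTE xyN.
  have := c_h (place le_vertex_n x) (place le_vertex_n y).
  rewrite adj_embed_place /switched_adj xyN addbF cxy eqxx.
  by rewrite base_adj_clique_set 1?eq_sym// => /(_ isT).
by have [->] := etrans (blocksE _ c_ij) (esym (blocksE _ c_kl)).
Qed.

End SwitchedGraph.

Lemma block_count_bounds (lam n : nat) : 0 < lam -> 8 * lam <= n ->
  exists p, [/\ 1 < p, 4 * (lam * p) <= n & n <= lam * (6 * p)].
Proof.
move=> lam_gt0 lam8n; exists (n %/ (4 * lam)).
have lam4_gt0 : 0 < 4 * lam by rewrite muln_gt0.
have p_gt1 : 1 < n %/ (4 * lam) by rewrite leq_divRL//; lia.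
have := leq_trunc_div n (4 * lam); have := ltn_ceil n lam4_gt0.
by split; nia.
Qed.

Local Open Scope classical_set_scope.
Local Open Scope ring_scope.

Lemma square_ratio_le (R : realFieldType) (k m n : nat) :
  (0 < k)%N -> (n <= k * m)%N -> n%:R ^+ 2 / k%:R ^+ 2 <= m%:R ^+ 2 :> R.
Proof.
move=> k_gt0 nkm; rewrite ler_pdivrMr ?exprn_gt0 ?ltr0n// -exprMn -natrM.
by rewrite lerXn2r ?nnegrE// ler_nat mulnC.
Qed.

Theorem theorem5p14 (R : realType) :
  exists (c : R) (C : nat), 0 < c /\
  forall lambda n : nat, (1 <= lambda)%N -> (C * lambda <= n)%N ->
  forall (d : measure_display) (T : measurableType d) (P : probability T R)
    (A : nat -> rand_query_alg T n {ffun 'I_n -> nat}),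
  (forall (kappa : nat) (G : query_graph n), degeneracy G = kappa ->
     ((2 / 3)%R%:E <=
        P [set r | proper_coloring (kappa + lambda)%N G (run G (A kappa r))])%E) ->
  exists (kappa : nat) (G : query_graph n), degeneracy G = kappa /\
    (0 < P [set r | (c * (n%:R ^+ 2 / lambda%:R ^+ 2)
                       <= (num_queries G (A kappa r))%:R)%R])%E.
Proof.
exists 144^-1, 8%N; split=> // lambda n lambda_gt0.
case/(block_count_bounds lambda_gt0) => p [p_gt1 n_ge n_le] d T P A A_ok.
have le_vertex_n : (#|vertex lambda p| <= n)%N by rewrite card_vertex.
pose kappa := switched_degeneracy lambda p.
pose G ij := switched_graph le_vertex_n (Some ij).
have GE ij : degeneracy (G ij) = kappa by exact: degeneracy_switched_graph.
pose Q := (p ^ 2 %/ 4)%N.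
have count_lt : (1 * Q + 1)%:R < 2 / 3 * #|{: 'I_p * 'I_p}|%:R :> R.
  rewrite card_prod card_ord mul1n natrD natrM.
  have := leq_trunc_div (p ^ 2) 4; rewrite -/Q -(ler_nat R) !natrM.
  by have : 2 <= p%:R :> R; [rewrite ler_nat | nra].
have threshold_le : 144^-1 * (n%:R ^+ 2 / lambda%:R ^+ 2) <= Q.+1%:R :> R.
  have := square_ratio_le R lambda_gt0 n_le.
  have := ltn_ceil (p ^ 2) (isT : (0 < 4)%N).
  by rewrite -/Q -(ltr_nat R) !natrM; lra.
have [ij long_ij] := exists_long_run (card_pair_query_changes_le1 le_vertex_n)
  (card_nbr_query_changes_le1 le_vertex_n)
  (card_properly_colored_le1 lambda_gt0 p_gt1 le_vertex_n)
  (fun ij => A_ok kappa (G ij) (GE ij)) count_lt threshold_le.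
by exists kappa, (G ij).
Qed.
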